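(* Let $(X,K,\|\cdot\|)$ be a real ordered Banach space whose closed cone $K$ is normal and satisfies $\mathrm{int}(K)\neq\varnothing$. Let $\{S_t\}_{t\ge 0}$ be a positive $C_0$-semigroup of operators in $L(X)$ such that 1) for each vector $x\in K$, $x\ne 0$, there exists a number $t_x\in[0,\infty)$ such that $S_{t_x}(x)\in \mathrm{int}(K)$; 2) for some $\tau>0$ the operator $S_\tau$ is compact; 3) $\sup_{t\ge 0}\|S_t\|<\infty$. Then the family $\{S_t\}_{t\ge0}$ converges pointwise (i.e. in norm at each $x\in X$) for $t\to+\infty$ to some operator $A_0\in L(X)$. If $A_0$ is not the zero operator, then there exist a vector $u\in \mathrm{int}(K)$ and a functional $f_0\in K'$, $f_0\ne 0$, such that (i) $S_t(u)=u$ and $S_t^*(f_0)=f_0$ for any $t\ge 0$, and moreover $f_0(x)>0$ if $x\in K$, $x\neq 0$; (ii) $A_0=f_0\otimes u$; (iii) for each $f\in X'$ one has $S_t^*(f)\to A_0^*(f)$ as $t\to\infty$ with respect to the weak*-topology $\sigma(X',X)$; (iv) $\lambda=1$ is a simple eigenvalue of the operators $S_t$ and $S_t^*$ for all $t>0$. Moreover (whether or not $A_0$ is zero), (v) $\|S_t-A_0\|\to 0$ as $t\to\infty$, i.e. the operators $S_t$ (and also the adjoint operators $S_t^*$) converge to $A_0$ (respectively to $A_0^*$) with respect to the operator norm.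
   Context: A cone $K$ in a real vector space is a nonempty subset with $\lambda x+\mu y\in K$ for $x,y\in K$, $\lambda,\mu\ge 0$, and such that $x,-x\in K$ implies $x=0$. An ordered Banach space $(X,K,\|\cdot\|)$ is a real Banach space $X$ ordered by a closed cone $K$ ($x\le y$ iff $y-x\in K$). $K$ is normal if there is $\delta>0$ with $\|x+y\|\ge\delta\max\{\|x\|,\|y\|\}$ for all $x,y\in K$. $\mathrm{int}(K)$ is the norm interior of $K$. $X'$ is the dual of $X$ and $K'=\{f\in X': f(x)\ge 0 \text{ for all } x\in K\}$. $L(X)$ is the space of continuous linear operators on $X$; $A\in L(X)$ is positive if $A(K)\subset K$; $A^*$ is its adjoint on $X'$. A positive $C_0$-semigroup is a family $\{S_t\}_{t\ge0}\subset L(X)$ of positive operators with $S_0=I$, $S_{s+t}=S_sS_t$ for $s,t\ge0$, and $t\mapsto S_t(x)$ norm-continuous on $[0,+\infty)$ for each $x\in X$. For $f\in X'$, $u\in X$, $f\otimes u$ is the operator $x\mapsto f(x)u$. An eigenvalue is called simple if its eigenspace is one-dimensional. *)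

(* Defs.v *)
From HB Require Import structures.
From mathcomp Require Import all_boot all_order all_algebra.
From mathcomp Require Import all_classical all_reals all_analysis.

Set Implicit Arguments.
Unset Strict Implicit.
Unset Printing Implicit Defensive.

Import Order.TTheory GRing.Theory Num.Theory.
Import numFieldNormedType.Exports.

Local Open Scope classical_set_scope.
Local Open Scope ring_scope.

Section continuous_linear.
Context {R : realType} (X Y : normedModType R).

Definition clin_pred : {pred X -> Y} :=
  mem [set f : X -> Y | linear f /\ continuous f].

Lemma clin_submod : submod_closed clin_pred.
Proof.
split.
  apply/mem_set; split => [a x y|x]; last exact: cvg_cst.
  by rewrite -![(0 : X -> Y) _]/(0 : Y) scaler0 addr0.
move=> k f g /set_mem[lf cf] /set_mem[lg cg]; apply/mem_set; split.
  move=> a x y; rewrite -![(k *: f + g) _]/(k *: f _ + g _) lf lg.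
  by rewrite !scalerDr !scalerA mulrC addrACA.
by move=> x; apply: cvgD; [apply: cvgZr; exact: cf|exact: cg].
Qed.

HB.instance Definition _ := GRing.isSubmodClosed.Build R (X -> Y) clin_pred
  clin_submod.

(* L(X, Y), made below into a normed module for the operator norm *)
Record clin := Clin { clin_fun :> X -> Y ; clinP : clin_fun \in clin_pred }.

HB.instance Definition _ := [isSub of clin for clin_fun].
HB.instance Definition _ := [Choice of clin by <:].
HB.instance Definition _ := [SubChoice_isSubLmodule of clin by <:].

Definition mkclin (f : X -> Y) (lf : linear f) (cf : continuous f) : clin :=
  Clin (mem_set (conj lf cf)).

Lemma clin_linear (T : clin) : linear T.
Proof. by have /set_mem[] := clinP T. Qed.

Lemma clin_continuous (T : clin) : continuous T.
Proof. by have /set_mem[] := clinP T. Qed.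

HB.instance Definition _ (T : clin) :=
  GRing.isLinear.Build R X Y _ (clin_fun T) (@clin_linear T).

Lemma clin_ext (S T : clin) : S = T :> (X -> Y) -> S = T.
Proof. exact: val_inj. Qed.

Definition clin_norm (T : clin) : R :=
  sup [set `|T x| | x in [set x : X | `|x| <= 1]].

Lemma clin_bounded (T : clin) : exists2 M : R, 0 < M & forall x, `|T x| <= M * `|x|.
Proof.
have /linear_bounded_continuous/linear_boundedP H := @clin_continuous T.
near (+oo : set_system R) => M; exists M; near: M; last exact: H.
exact: nbhs_pinfty_gt.
Unshelve. all: by end_near. Qed.

Lemma clin_norm_has_sup (T : clin) :
  has_sup [set `|T x| | x in [set x : X | `|x| <= 1]].
Proof.
split; first by exists `|T 0|, 0 => //=; rewrite normr0.
have [M M0 TM] := clin_bounded T; exists M => _ [x /= x1 <-].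
by rewrite (le_trans (TM x))// ler_piMr// ltW.
Qed.

Lemma clin_norm_ub (T : clin) x : `|x| <= 1 -> `|T x| <= clin_norm T.
Proof.
by move=> x1; apply: (sup_upper_bound (clin_norm_has_sup T)); exists x.
Qed.

Lemma clin_norm_le (T : clin) (M : R) :
  (forall x, `|x| <= 1 -> `|T x| <= M) -> clin_norm T <= M.
Proof.
move=> TM; apply: ge_sup; first exact: (clin_norm_has_sup T).1.
by move=> _ [x /= x1 <-]; exact: TM.
Qed.

Lemma clin_norm_ge0 (T : clin) : 0 <= clin_norm T.
Proof. by apply: le_trans (@clin_norm_ub T 0 _); rewrite ?normr0. Qed.

Lemma le_clin_norm (T : clin) x : `|T x| <= clin_norm T * `|x|.
Proof.
have [->|x0] := eqVneq x 0; first by rewrite linear0 !normr0 mulr0.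
have nx0 : 0 < `|x| by rewrite normr_gt0.
rewrite -ler_pdivrMr// mulrC -[X in X * _]gtr0_norm ?invr_gt0// -normrZ -linearZ.
by apply: clin_norm_ub; rewrite normrZ gtr0_norm ?invr_gt0// mulVf// gt_eqF.
Qed.

Lemma clin_normD (S T : clin) : clin_norm (S + T) <= clin_norm S + clin_norm T.
Proof.
apply: clin_norm_le => x x1; rewrite -[(S + T) x]/(S x + T x).
by rewrite (le_trans (ler_normD _ _))// lerD// clin_norm_ub.
Qed.

Lemma clin_normZ (l : R) (T : clin) : clin_norm (l *: T) = `|l| * clin_norm T.
Proof.
have H k (U : clin) : clin_norm (k *: U) <= `|k| * clin_norm U.
  apply: clin_norm_le => x x1; rewrite -[(k *: U) x]/(k *: U x) normrZ.
  by rewrite ler_wpM2l// clin_norm_ub.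
apply/eqP; rewrite eq_le H/=; have [->|l0] := eqVneq l 0.
  by rewrite normr0 mul0r clin_norm_ge0.
rewrite -[in X in X <= _](scalerK l0 T) -ler_pdivlMl ?normr_gt0// -normfV.
exact: H.
Qed.

Lemma clin_norm0_eq0 (T : clin) : clin_norm T = 0 -> T = 0.
Proof.
move=> T0; apply: clin_ext; apply/funext => x; apply/eqP.
rewrite -[(0 : clin) x]/(0 : Y) -normr_le0.
by rewrite (le_trans (le_clin_norm _ _))// T0 mul0r.
Qed.

HB.instance Definition _ :=
  Lmodule_isNormed.Build R clin clin_normD clin_normZ clin_norm0_eq0.

Lemma clin_normE (T : clin) :
  `|T| = sup [set `|T x| | x in [set x : X | `|x| <= 1]].
Proof. by []. Qed.

End continuous_linear.

Section dual.
Context {R : realType}.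
Implicit Types X Y : normedModType R.

Definition dual X := clin X R^o.

HB.instance Definition _ X := NormedModule.on (dual X).

Lemma adjoint_subproof X Y (A : clin X Y) (f : dual Y) :
  linear (f \o A) /\ continuous (f \o A).
Proof.
split; first by move=> a x y /=; rewrite !linearP.
by move=> x; apply: continuous_comp; exact: clin_continuous.
Qed.

Definition adjoint_fun X Y (A : clin X Y) (f : dual Y) : dual X :=
  mkclin (adjoint_subproof A f).1 (adjoint_subproof A f).2.

Lemma adjoint_linear X Y (A : clin X Y) : linear (adjoint_fun A).
Proof. by move=> a f g; exact: clin_ext. Qed.

Lemma adjoint_continuous X Y (A : clin X Y) : continuous (adjoint_fun A).
Proof.
pose A' : {linear dual Y -> dual X} :=
  HB.pack (adjoint_fun A) (GRing.isLinear.Build _ _ _ _ _ (adjoint_linear A)).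
apply: (@bounded_linear_continuous _ _ _ A').
apply/linear_boundedP; near=> M => f; apply: clin_norm_le => x x1.
apply: (le_trans (le_clin_norm f (A x))).
rewrite [leRHS]mulrC; apply: ler_wpM2l; first exact: clin_norm_ge0.
apply: (le_trans (clin_norm_ub A x1)); near: M.
by apply: nbhs_pinfty_ge; rewrite num_real.
Unshelve. all: by end_near. Qed.

Definition adjoint X Y (A : clin X Y) : clin (dual Y) (dual X) :=
  mkclin (@adjoint_linear X Y A) (@adjoint_continuous X Y A).

Lemma tensor_subproof X Y (f : dual X) (u : Y) :
  linear (fun x => (f x : R) *: u) /\ continuous (fun x => (f x : R) *: u).
Proof.
split; first by move=> a x y; rewrite linearP scalerDl scalerA.
by move=> x; apply: cvgZl; exact: clin_continuous.
Qed.

Definition tensor X Y (f : dual X) (u : Y) : clin X Y :=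
  mkclin (tensor_subproof f u).1 (tensor_subproof f u).2.

(* The dual with the topology sigma(X', X), induced by the topology of
   pointwise convergence. *)
Definition weak_star X : topologicalType :=
  initial_topology (fun f : dual X => (f : X -> R^o) : {ptws X -> R^o}).

End dual.

Section cones.
Context {R : realType} {X : normedModType R}.
Implicit Types (K : set X) (T : clin X X).

Definition cone K :=
  [/\ K !=set0,
      forall x y (a b : R), K x -> K y -> 0 <= a -> 0 <= b -> K (a *: x + b *: y)
    & forall x, K x -> K (- x) -> x = 0].

Definition normal_cone K := exists2 d : R, 0 < d &
  forall x y, K x -> K y -> d * Num.max `|x| `|y| <= `|x + y|.

Definition dual_cone K : set (dual X) :=
  [set f | forall x, K x -> 0 <= (f x : R)].

Definition positive_op K T := forall x, K x -> K (T x).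

Definition compact_op T := precompact (T @` [set x | `|x| <= 1]).

(* The values of S at negative times are irrelevant. *)
Definition positive_C0_semigroup K (S : R -> clin X X) :=
  [/\ forall t, 0 <= t -> positive_op K (S t),
      S 0 = idfun :> (X -> X),
      forall s t, 0 <= s -> 0 <= t -> S (s + t) = S s \o S t :> (X -> X)
    & forall x, {within `[0, +oo[, continuous (fun t => S t x)}].

End cones.

Section eigenvalues.
Context {R : realType} {X : normedModType R}.

Definition eigenspace_op (T : clin X X) (a : R) : set X :=
  [set x | T x = a *: x].

Definition simple_eigenvalue (T : clin X X) (a : R) :=
  exists2 v, v != 0 & eigenspace_op T a = [set c *: v | c in [set: R]].

End eigenvalues.

(* Main.v *)
Require Import Defs.
From HB Require Import structures.
From mathcomp Require Import all_boot all_order all_algebra.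
From mathcomp Require Import all_classical all_reals all_analysis.
From mathcomp Require Import ring lra.

Set Implicit Arguments.
Unset Strict Implicit.
Unset Printing Implicit Defensive.

Import Order.TTheory GRing.Theory Num.Theory.
Import numFieldNormedType.Exports.

Local Open Scope classical_set_scope.
Local Open Scope ring_scope.

(** An interior point e of K is an order unit, so by normality the norm of a
    positive operator T is comparable with the norm of T e. Hence only the
    orbit of e matters. If S_t e comes arbitrarily close to 0, then
    boundedness of the semigroup gives S_t -> 0 in norm, and A_0 = 0.

    Otherwise the orbit of e under the powers P_n = S_(n tau) of the compact
    operator S_tau stays away from 0. By compactness, one power of S_tau sends
    all normalized orbit points into the interior of K, with a uniform margin
    ([uniform_interior]); so P_n e >= c e for all large n, with some c > 0
    ([orbit_lower_bound]). The Cesaro means of the orbit then cluster at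
    a vector u >= c e fixed by S_tau ([interior_fixed_point]).

    Given such a u, each orbit P_n x approaches a multiple of u
    ([orbit_limit]). Let M be the infimum of the l such that P_n x <= l u for
    some n. A cluster point y of the orbit satisfies y <= M u. If y <> M u,
    then some P_k maps M u - y into the interior of K, so that
    P_k y <= (M - d) u with a margin, which is inherited by some P_n x:
    this contradicts the choice of M. Hence y = M u.

    Applied to x = S_s u this gives S_s u = c u, and c = 1 because the orbit of
    u is bounded and returns to u ([fixed_vector_eigenvalue]). So u is fixed by
    the whole semigroup and S_t x -> f(x) u for every x, where the functional f
    is linear and continuous as a bounded pointwise limit. It is invariant, and
    strictly positive because S_t x dominates a positive multiple of u for some
    t. Fixed vectors of S_t, and of its adjoint, are found by passing to the
    limit along the multiples of t. Finally, pointwise convergence of a bounded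
    family is uniform on the compact closure of the image of the unit ball under
    S_tau, and S_(t + tau) - A_0 = (S_t - A_0) S_tau, so the convergence holds
    in norm ([semigroup_uniform_cvg]). *)

(** * Cones with interior points *)

Section cone_order.
Context {R : realType} {X : normedModType R} (K : set X) (coneK : cone K).

Lemma cone0 : K 0.
Proof.
have [[x Kx] lin _] := coneK.
by have := lin x x 0 0 Kx Kx (lexx _) (lexx _); rewrite !scale0r addr0.
Qed.

Lemma coneZ (a : R) x : 0 <= a -> K x -> K (a *: x).
Proof.
move=> a0 Kx; have [_ lin _] := coneK.
by have := lin x x a 0 Kx Kx a0 (lexx _); rewrite scale0r addr0.
Qed.

Lemma coneD x y : K x -> K y -> K (x + y).
Proof.
move=> Kx Ky; have [_ lin _] := coneK.
by have := lin x y 1 1 Kx Ky ler01 ler01; rewrite !scale1r.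
Qed.

Lemma interior_ball x : K° x -> exists2 e : R, 0 < e &
  forall y, `|y - x| < e -> K° y.
Proof.
move=> /nbhs_interior/nbhs_ballP[e /= e0 xeK]; exists e => // y yx.
by apply: xeK; rewrite -ball_normE/= distrC.
Qed.

Lemma interior_of_ball x (e : R) : 0 < e ->
  (forall y, `|y - x| < e -> K y) -> K° x.
Proof.
move=> e0 xeK; apply/nbhs_ballP; exists e => //= y.
by rewrite -ball_normE/= distrC; exact: xeK.
Qed.

Lemma interior_coneD x y : K° x -> K y -> K° (x + y).
Proof.
move=> /interior_ball[e e0 xeK] Ky; apply: (interior_of_ball e0) => z zxy.
rewrite -(subrK y z); apply: coneD => //.
by apply: interior_subset; apply: xeK; rewrite -addrA -opprD [y + x]addrC.
Qed.

Lemma interior_coneZ (a : R) x : 0 < a -> K° x -> K° (a *: x).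
Proof.
move=> a0 /interior_ball[e e0 xeK]; apply: (@interior_of_ball _ (a * e)).
  exact: mulr_gt0.
move=> z zx; rewrite -(scalerKV (lt0r_neq0 a0) z); apply: (coneZ (ltW a0)).
apply: interior_subset; apply: xeK.
rewrite -(scalerK (lt0r_neq0 a0) x) -scalerBr normrZ gtr0_norm ?invr_gt0//.
by rewrite ltr_pdivrMl.
Qed.

Lemma interior_ge (c : R) x y : 0 < c -> K° x -> K (y - c *: x) -> K° y.
Proof.
move=> c0 Kx Ky; rewrite -(subrK (c *: x) y) addrC.
exact: interior_coneD (interior_coneZ c0 Kx) Ky.
Qed.

Lemma interior_subZ x y : K° x -> exists2 c : R, 0 < c & K° (x - c *: y).
Proof.
move=> /interior_ball[e e0 xeK].
have y1 : 0 < `|y| + 1 by rewrite ltr_wpDl.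
exists (e / (`|y| + 1)); first exact: divr_gt0.
apply: xeK; rewrite addrAC subrr sub0r normrN normrZ gtr0_norm ?divr_gt0//.
by rewrite mulrAC ltr_pdivrMr// ltr_pM2l// ltrDl.
Qed.

(** Interior points are order units, with one constant for all vectors: their
    multiples dominate balls. *)
Lemma interior_order_unit u : K° u -> exists2 c : R, 0 < c &
  forall x (a : R), `|x| <= a -> K ((c * a) *: u - x).
Proof.
move=> /interior_ball[e e0 ueK]; exists (2 / e); first exact: divr_gt0.
move=> x a xa; have [a0|a0] := leP a 0.
  have /eqP x0 : x == 0 by rewrite -normr_le0 (le_trans xa).
  have -> : a = 0 by apply/le_anti; rewrite a0 (le_trans _ xa).
  by rewrite x0 mulr0 scale0r subr0; exact: cone0.
have ea : 0 < 2 / e * a by rewrite mulr_gt0// divr_gt0.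
rewrite -[X in _ - X](scalerKV (lt0r_neq0 ea) x) -scalerBr.
apply: (coneZ (ltW ea)); apply: interior_subset; apply: ueK.
rewrite addrAC subrr sub0r normrN normrZ gtr0_norm ?invr_gt0// ltr_pdivrMl//.
rewrite mulrAC divfK ?gt_eqF//; lra.
Qed.

(** Images of unit vectors lie in the order interval between the images of
    two multiples of the order unit, and order intervals of a normal cone are
    bounded. *)
Lemma normal_op_bound : normal_cone K -> forall u, K° u ->
  exists2 C : R, 0 < C & forall T : clin X X, positive_op K T ->
    `|T| <= C * `|T u|.
Proof.
move=> [d d0 dK] u /interior_order_unit[c c0 cu].
have d1 : 0 < d^-1 by rewrite invr_gt0.
exists (c * (2 / d + 1)); first by rewrite mulr_gt0// addr_gt0// divr_gt0.
move=> T TK; apply: clin_norm_le => x x1.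
have Kl : K (T (c *: u - x)) by apply: TK; have := cu x 1 x1; rewrite mulr1.
have Kr : K (T (c *: u + x)).
  by apply: TK; have := cu (- x) 1; rewrite normrN mulr1 opprK; exact.
have := dK _ _ Kl Kr; rewrite -linearD addrACA addNr addr0.
rewrite -scalerDl linearZ normrZ gtr0_norm ?addr_gt0// => le1.
have le2 : `|T (c *: u + x)| <= d^-1 * ((c + c) * `|T u|).
  rewrite -ler_pdivrMl ?invr_gt0// invrK (le_trans _ le1)// ler_pM2l//.
  by rewrite le_max lexx orbT.
have -> : T x = T (c *: u + x) - c *: T u.
  by rewrite linearD linearZ/= addrAC subrr add0r.
rewrite (le_trans (ler_normB _ _))// normrZ gtr0_norm//.
apply: (@le_trans _ _ (d^-1 * ((c + c) * `|T u|) + c * `|T u|)).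
  by rewrite lerD2r.
by rewrite le_eqVlt; apply/orP; left; apply/eqP; ring.
Qed.

Lemma coneZ_ge0 (l : R) x : K x -> x != 0 -> K (l *: x) -> 0 <= l.
Proof.
move=> Kx x0 Klx; rewrite leNgt; apply/negP => l0; move/eqP: x0; apply.
have [_ _] := coneK; apply=> //.
have -> : - x = (- l)^-1 *: (l *: x).
  by rewrite scalerA invrN mulNr mulVf ?lt_eqF// scaleN1r.
by apply: coneZ => //; rewrite invr_ge0 oppr_ge0 ltW.
Qed.

Lemma closed_approx x : closed K ->
  (forall e : R, 0 < e -> exists2 y, K y & `|y - x| < e) -> K x.
Proof.
move=> cK Kx; apply: cK => U /nbhs_ballP[e /= e0 eU].
have [y Ky yx] := Kx e e0; exists y; split=> //; apply: eU.
by rewrite -ball_normE/= distrC.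
Qed.

End cone_order.

(** * Compact sets and compact operators *)

Section compactness.
Context {R : realType} {X : normedModType R}.

Lemma compact_seq_cluster (C : set X) (x_ : nat -> X) :
  compact C -> (forall n, C (x_ n)) ->
  exists2 y, C y & forall (e : R), 0 < e -> forall N,
    exists2 n, (N <= n)%N & `|x_ n - y| < e.
Proof.
move=> cC Cx; have [|y [Cy xy]] := cC (x_ @ \oo) _.
  by exists 0%N => // n _; exact: Cx.
exists y => // e e0 N.
have [] := xy (x_ @` [set n | (N <= n)%N]) (ball y e).
- by exists N => // n /= Nn; exists n.
- exact: nbhsx_ballx.
- move=> _ [[n /= Nn <-]]; rewrite -ball_normE/= distrC => xye.
  by exists n.
Qed.

(** The sequence itself is only bounded: it is rescaled into the unit ball, on
    which compactness of T is stated. *)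
Lemma compact_op_cluster (T : clin X X) (r : R) (x_ : nat -> X) :
  compact_op T -> (forall n, `|x_ n| <= r) ->
  exists y, forall (e : R), 0 < e -> forall N,
    exists2 n, (N <= n)%N & `|T (x_ n) - y| < e.
Proof.
move=> cT xr; pose s := r + 1.
have s0 : 0 < s by rewrite ltr_wpDl// (le_trans _ (xr 0%N)).
have [||y _ yP] := @compact_seq_cluster (closure (T @` [set x | `|x| <= 1]))
    (fun n => T (s^-1 *: x_ n)).
- by rewrite -precompactE.
- move=> n; apply: subset_closure; exists (s^-1 *: x_ n) => //=.
  rewrite normrZ gtr0_norm ?invr_gt0// ler_pdivrMl// mulr1.
  by rewrite (le_trans (xr n))// lerDl.
exists (s *: y) => e e0 N.
have [|n Nn xye] := yP (e / s) _ N; first exact: divr_gt0.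
exists n => //; rewrite -(scalerKV (lt0r_neq0 s0) (x_ n)) linearZ/= -scalerBr.
by rewrite normrZ gtr0_norm// mulrC -ltr_pdivlMr.
Qed.

End compactness.

(** * Discrete semigroups *)

(** The powers of one operator are given as a family P indexed by nat, which is
    later instantiated by the times n tau of a continuous semigroup. *)
Section discrete_semigroup.
Context {R : realType} {X : normedModType R} (K : set X) (coneK : cone K).
Context (closedK : closed K) (P : nat -> clin X X) (B : R).
Context (P0 : forall x, P 0 x = x).
Context (PD : forall m n x, P (m + n) x = P m (P n x)).
Context (PK : forall n, positive_op K (P n)).
Context (intP : forall n x, K° x -> K° (P n x)).
Context (Pint : forall x, K x -> x != 0 -> exists n, K° (P n x)).
Context (P1 : compact_op (P 1)).
Context (B0 : 0 < B) (PB : forall n x, `|P n x| <= B * `|x|).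

(** Each y in C enters the interior at some time, together with a neighbourhood
    of y, and stays there afterwards; so finitely many neighbourhoods yield one
    time N for all of C. A second covering argument, now over small c > 0, turns
    membership of P N y in the interior into a uniform margin. *)
Lemma uniform_interior (C : set X) (e : X) : compact C ->
  (forall y, C y -> K y /\ y != 0) ->
  exists N, exists2 c : R, 0 < c & forall y, C y -> K (P N y - c *: e).
Proof.
move=> /compact_near_coveringP cC CK.
have [N _ NC] : \forall n \near \oo, C `<=` [set y | K° (P n y)].
  apply: (cC nat \oo (fun n y => K° (P n y))) => y /CK[Ky /(Pint Ky)[N yN]].
  have nN : nbhs y [set y' | K° (P N y')].
    by apply: (@clin_continuous _ _ _ (P N)); exact: nbhs_interior.
  exists ([set y' | K° (P N y')], [set n | (N <= n)%N]).
    by split=> //; exists N.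
  by move=> [y' n] /= [y'N Nn]; rewrite -(subnK Nn) PD; exact: intP.
exists N.
have : \forall c \near (0 : R)^'+, C `<=` [set y | K (P N y - c *: e)].
  apply: (cC R (0 : R)^'+ (fun c y => K (P N y - c *: e))) => y Cy.
  have : (fun p : X * R => P N p.1 - p.2 *: e) p @[p --> (y, 0)] --> P N y.
    rewrite -[X in _ --> X]subr0 -[X in _ - X](scale0r e).
    apply: cvgB.
      apply: (@cvg_comp _ _ _ fst (P N)); first exact: cvg_fst.
      exact: clin_continuous.
    by apply: cvgZr_tmp; exact: (@cvg_snd _ _ (nbhs y) (nbhs (0 : R))).
  move=> /(_ K (NC N (leqnn N) y Cy)).
  case=> -[U V] /= [yU V0] UVK; exists (U, V).
    by split=> //; exact: cvg_within.
  by move=> [y' c] /= UV; exact: (UVK (y', c)).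
move=> H; near (0 : R)^'+ => c; exists c; first by near: c; exact: nbhs_right_gt.
by near: c.
Unshelve. all: by end_near. Qed.

(** The normalized orbit points P (n + 1) e stay in a compact subset of K that
    avoids 0, because they are images of a bounded sequence under the compact
    operator P 1. *)
Lemma orbit_lower_bound (e : X) (d : R) : K° e -> 0 < d ->
  (forall n, d <= `|P n e|) ->
  exists N, exists2 c : R, 0 < c &
    forall n, K (P (n + N) e - c *: e).
Proof.
move=> Ke d0 de.
have e0 : 0 < `|e| by rewrite (lt_le_trans d0)// -[X in `|X|]P0.
set s := B * `|e|; have s0 : 0 < s by exact: mulr_gt0.
pose C := (closure (P 1 @` [set x | `|x| <= 1]) `&` K) `&`
  [set y | d / s <= `|y|].
have cC : compact C.
  apply: compact_closedI; first by apply: compact_closedI; rewrite -?precompactE.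
  apply: (@closed_comp _ _ (fun y : X => `|y|) [set r | d / s <= r]).
    by move=> y _; exact: norm_continuous.
  exact: closed_ge.
have [|N [c c0 NC]] := uniform_interior e cC.
  move=> y [[_ Ky] /= dy]; split=> //.
  by rewrite -normr_gt0 (lt_le_trans _ dy)// divr_gt0.
exists N.+1; exists (s * c); first exact: mulr_gt0.
move=> n; have -> : P (n + N.+1) e = s *: P N (s^-1 *: P n.+1 e).
  by rewrite linearZ/= scalerKV ?gt_eqF// -PD !addnS addnC.
rewrite -scalerA -scalerBr; apply: (coneZ coneK (ltW s0)); apply: NC.
split; first split.
- apply: subset_closure; exists (s^-1 *: P n e) => /=.
    rewrite normrZ gtr0_norm ?invr_gt0// ler_pdivrMl// mulr1; exact: PB.
  by rewrite linearZ/= -PD.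
- apply: (coneZ coneK); first by rewrite invr_ge0 ltW.
  by apply: PK; exact: interior_subset.
- by rewrite /= normrZ gtr0_norm ?invr_gt0// mulrC ler_pM2l ?invr_gt0.
Qed.

(** Mean ergodic argument: the Cesaro means a n of the orbit are almost fixed,
    compactness of P 1 makes their images cluster, and the lower bound on the
    orbit keeps the cluster point in the interior. *)
Lemma interior_fixed_point (e : X) (d : R) : K° e -> 0 < d ->
  (forall n, d <= `|P n e|) ->
  exists u, [/\ u != 0, K° u & P 1 u = u].
Proof.
move=> Ke d0 de; have [N [c c0 Nc]] := orbit_lower_bound Ke d0 de.
pose w := P N e.
pose a n := n.+1%:R^-1 *: \sum_(k < n.+1) P k w.
have inv_gt0 n : 0 < n.+1%:R^-1 :> R by rewrite invr_gt0.
have ar n : `|a n| <= B * `|w|.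
  rewrite normrZ gtr0_norm// ler_pdivrMl//.
  rewrite (le_trans (ler_norm_sum _ _ _))//.
  rewrite (le_trans (ler_sum _ (fun (k : 'I_n.+1) _ => PB k w)))//.
  by rewrite sumr_const card_ord -[leLHS]mulr_natl.
have [u uP] := compact_op_cluster P1 ar.
have aK n : K (P 1 (a n) - c *: e).
  have -> : c *: e = n.+1%:R^-1 *: \sum_(k < n.+1) c *: e.
    rewrite sumr_const card_ord -[(c *: e) *+ _]scaler_nat.
    by rewrite scalerK// pnatr_eq0.
  rewrite linearZ/= -scalerBr; apply: (coneZ coneK); first exact/ltW/inv_gt0.
  rewrite linear_sum -sumrB; apply: big_ind; first exact: cone0.
    by move=> x y; exact: coneD.
  by move=> k _; rewrite /= /w -!PD; exact: Nc.
have aP n : `|P 1 (a n) - a n| <= n.+1%:R^-1 * (2 * (B * `|w|)).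
  have -> : P 1 (a n) - a n = n.+1%:R^-1 *: (P n.+1 w - P 0 w).
    rewrite linearZ/= -scalerBr linear_sum; congr (_ *: _).
    rewrite -(telescope_sumr (fun k => P k w))// big_mkord sumrB.
    by congr (_ - _); apply: eq_bigr => k _ /=; rewrite -PD.
  rewrite normrZ gtr0_norm// ler_pM2l// mulr_natl mulr2n.
  by rewrite (le_trans (ler_normB _ _))// lerD.
have Ku : K (u - c *: e).
  apply: closed_approx => // eps eps0; have [n _ xu] := uP eps eps0 0%N.
  by exists (P 1 (a n) - c *: e) => //; rewrite opprB addrA subrK.
exists u; split.
- have e0 : e != 0 by rewrite -normr_gt0 (lt_le_trans d0)// -[X in `|X|]P0.
  apply: contraNneq e0 => u0; rewrite u0 sub0r in Ku.
  have Kce : K (c *: e) by apply: coneZ (ltW c0) (interior_subset Ke).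
  have [_ _ /(_ _ Kce Ku)/eqP] := coneK.
  by rewrite scaler_eq0 gt_eqF.
- exact: interior_ge c0 Ke Ku.
apply/eqP; rewrite -subr_eq0 -normr_le0; apply/ler_addgt0Pr => eps eps0.
rewrite add0r.
have BB : 0 < B + 1 by exact: addr_gt0.
set D := B * (2 * (B * `|w|)) + 1.
have D0 : 0 < D by rewrite ltr_wpDl// !mulr_ge0// ltW.
have eps2 : 0 < eps / 2 by exact: divr_gt0.
have [N1 _ N1P] : \forall n \near \oo, n.+1%:R^-1 < eps / 2 / D :> R.
  exact: (near_infty_natSinv_lt (PosNum (divr_gt0 eps2 D0))).
(* u is close to P 1 (a n), which is close to a n: one half of eps for each *)
have [n /N1P/= nN nu] := uP (eps / 2 / (B + 1)) (divr_gt0 eps2 BB) N1.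
have arith (i q W p p1 t : R) : i * (B * W + 1) * 2 < t ->
    q * (B + 1) * 2 < t -> p1 <= B * (i * W) -> p <= B * q -> 0 < i ->
    p + (p1 + q) <= t by nra.
have -> : P 1 u - u =
    P 1 (u - P 1 (a n)) + (P 1 (P 1 (a n) - a n) + (P 1 (a n) - u)).
  by rewrite [P 1 (u - _)]linearB [P 1 (_ - a n)]linearB/= !subrKA.
move: nN nu; rewrite !ltr_pdivlMr// => nN nu.
have n1 := PB 1 (u - P 1 (a n)).
have n2 := le_trans (PB 1 (P 1 (a n) - a n)) (ler_wpM2l (ltW B0) (aP n)).
rewrite (le_trans (ler_normD _ _))//.
rewrite (le_trans (lerD (lexx _) (ler_normD _ _)))//.
rewrite distrC in n1.
exact: arith nN nu n2 n1 (inv_gt0 n).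
Qed.

(** The best constant M = inf L with P n x <= l u eventually, for l > M, is
    attained at every cluster point y of the orbit, and strict positivity
    excludes y <> M u. Only closeness at one time is asserted: since u is fixed
    and the powers are bounded, closeness persists. *)
Lemma orbit_limit (u : X) : u != 0 -> K° u -> P 1 u = u ->
  forall x, exists a : R, forall e : R, 0 < e ->
    exists n, `|P n x - a *: u| < e.
Proof.
move=> u0 Ku Pu1 x.
have Pu n : P n u = u by elim: n => [|n IHn]; rewrite ?P0// -addn1 PD Pu1.
have [c c0 cu] := interior_order_unit coneK Ku.
have PBx n : `|P n x| <= B * `|x| by exact: PB.
have [y yP] := compact_op_cluster P1 PBx.
pose L := [set l : R | exists n, K (l *: u - P n x)].
have L_inf : has_inf L.
  split; first by exists (c * `|x|), 0%N; rewrite P0; exact: cu.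
  exists (- (c * (B * `|x|))) => l [n Kl].
  rewrite -subr_ge0 opprK; apply: (coneZ_ge0 coneK (interior_subset Ku) u0).
  have := cu (- P n x) (B * `|x|); rewrite normrN => /(_ (PBx n)).
  by rewrite opprK scalerDl => /(coneD coneK Kl); rewrite addrACA addNr addr0.
(* the orbit is eventually below l u for l close to inf L, and K is closed *)
have Ky : K (inf L *: u - y).
  apply: closed_approx => // e e0.
  have nu : 0 < `|u| by rewrite normr_gt0.
  have e2 : 0 < e / 2 by exact: divr_gt0.
  have [l [n Kl] lL] := inf_adherent (divr_gt0 e2 nu) L_inf.
  have [m nm my] := yP (e / 2) e2 n.
  exists ((inf L + e / 2 / `|u|) *: u - P 1 (P m x)).
    have -> : (inf L + e / 2 / `|u|) *: u - P 1 (P m x) =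
        (inf L + e / 2 / `|u| - l) *: u + P (m.+1 - n) (l *: u - P n x).
      rewrite linearB linearZ/= Pu -!PD subnK ?(leqW nm)// scalerBl.
      by rewrite addrA subrK add1n.
    apply: (coneD coneK); last exact: PK.
    apply: coneZ => //; last exact: interior_subset.
    by rewrite subr_ge0 ltW.
  rewrite scalerDl opprB addrC addrA subrKA addrAC addrC.
  rewrite (le_lt_trans (ler_normD _ _))// normrZ gtr0_norm ?divr_gt0//.
  by rewrite divfK ?gt_eqF// [e in _ < e]splitr ltrD2l distrC.
exists (inf L) => e e0; have [n _ ny] := yP e e0 0%N; exists (1 + n)%N.
rewrite PD; have [<-//|yu] := eqVneq y (inf L *: u).
have [|k Kk] := Pint Ky; first by rewrite subr_eq0 eq_sym.
(* otherwise the upper constant could be improved by d at a later time *)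
have [d d0] := interior_subZ u Kk.
move=> /interior_ball[r r0 rK].
have [m _ my] := yP (r / B) (divr_gt0 r0 B0) 0%N.
suff : L (inf L - d).
  by move=> /(ge_inf L_inf.2); rewrite lerBrDr gerDl leNgt d0.
exists (k + (1 + m))%N; apply: interior_subset; apply: rK.
rewrite [P k (_ - y)]linearB linearZ/= Pu PD scalerBl [X in X - _]addrAC.
rewrite !opprB subrKA.
rewrite [X in `|X|]addrC subrKA -linearB (le_lt_trans (PB _ _))//.
by rewrite mulrC -ltr_pdivlMr// distrC PD.
Qed.

End discrete_semigroup.

(** * Convergence of operators in norm *)

Section operator_convergence.
Context {R : realType} {X : normedModType R}.
Context {I : Type} (F : set_system I) {FF : Filter F}.
Context (T : I -> clin X X) (A : clin X X).

Lemma adjointB (U V : clin X X) : adjoint U - adjoint V = adjoint (U - V).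
Proof.
apply: clin_ext; apply/funext => f; apply: clin_ext; apply/funext => x.
by rewrite -[RHS]/(f (U x - V x)) linearB.
Qed.

Lemma adjoint_norm_le (U : clin X X) : `|adjoint U| <= `|U|.
Proof.
apply: clin_norm_le => f f1; apply: clin_norm_le => x x1.
rewrite (le_trans (le_clin_norm f _))// -[leRHS]mul1r.
by apply: ler_pM => //; [exact: clin_norm_ge0|exact: clin_norm_ub].
Qed.

Lemma norm_cvg_pointwise x :
  `|T t - A| @[t --> F] --> (0 : R) -> T t x @[t --> F] --> A x.
Proof.
move=> /cvgr0Pnorm_lt TA; apply/cvgrPdist_lt => e e0.
have x1 : 0 < `|x| + 1 by rewrite ltr_wpDl.
have := TA _ (divr_gt0 e0 x1); apply: filterS => t.
rewrite normr_id ltr_pdivlMr// => TAe.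
rewrite distrC -[T t x - A x]/((T t - A) x).
rewrite (le_lt_trans (le_clin_norm (T t - A) x))// (le_lt_trans _ TAe)//.
by apply: ler_wpM2l; [exact: clin_norm_ge0|rewrite lerDl].
Qed.

Lemma norm_cvg_adjoint : `|T t - A| @[t --> F] --> (0 : R) ->
  `|adjoint (T t) - adjoint A| @[t --> F] --> (0 : R).
Proof.
move=> /cvgr0Pnorm_lt TA; apply/cvgr0Pnorm_lt => e e0.
have := TA _ e0; apply: filterS => t.
rewrite !normr_id adjointB; apply: le_lt_trans; exact: adjoint_norm_le.
Qed.

(** The weak-star topology is initial for the inclusion of the dual into the
    product topology, so a neighbourhood of the limit contains the preimage of an
    open set of functions. *)
Lemma pointwise_cvg_weak_star (f : dual X) :
  (forall x, T t x @[t --> F] --> A x) ->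
  (adjoint (T t) f : weak_star X) @[t --> F] --> (adjoint A f : weak_star X).
Proof.
move=> TA V [_ [[W oW <-] WA WV]].
pose G t : {ptws X -> R^o} := adjoint (T t) f : X -> R^o.
have : {ptws, G @ F --> (adjoint A f : X -> R^o)}.
  apply/pointwise_cvgP => x; apply: (@cvg_comp _ _ _ (fun t => T t x) f).
    exact: TA.
  exact: (@clin_continuous _ _ _ f (A x)).
move=> /(_ W (open_nbhs_nbhs (conj oW WA))) FW.
by apply: (@filterS _ F FF _ _ _ FW) => t Wt; exact: WV.
Qed.

End operator_convergence.

(** * Sampling along multiples of a period *)

Lemma expr_small {R : realType} (c e : R) : 0 <= c -> c < 1 -> 0 < e ->
  exists n, c ^+ n < e.
Proof.
move=> c0 c1 e0; have /cvgr0Pnorm_lt/(_ e e0)[n _ /(_ n (leqnn n))] :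
    (GRing.exp c : R ^nat) @ \oo --> 0 by apply: cvg_expr; rewrite ger0_norm.
by rewrite /= ger0_norm ?exprn_ge0//; exists n.
Qed.

Lemma multiple_above {R : realType} (tau t : R) : 0 < tau ->
  exists n : nat, t < n%:R * tau.
Proof.
move=> tau0; exists (Num.truncn (t / tau)).+1.
by rewrite -ltr_pdivrMr// truncnS_gt.
Qed.

Lemma cvg_constant_on_multiples {R : realType} {V : normedModType R}
    (h : R -> V) (t : R) (v w : V) : 0 < t ->
  (forall n : nat, h (n%:R * t) = v) -> h s @[s --> +oo] --> w -> w = v.
Proof.
move=> t0 hv /cvgrPdist_lt hw; apply/eqP.
rewrite -subr_eq0 -normr_le0; apply/ler_addgt0Pr => e e0.
have [M [_ ME]] := hw e e0; have [n Mn] := multiple_above M t0.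
by rewrite add0r ltW// -(hv n); exact: ME.
Qed.

(** * Continuous semigroups *)

Lemma scale_vector_inj {R : realType} {X : normedModType R} (u : X) :
  u != 0 -> injective (fun a : R => a *: u).
Proof.
move=> u0 a b /eqP; rewrite -subr_eq0 -scalerBl scaler_eq0 (negPf u0) orbF.
by rewrite subr_eq0 => /eqP.
Qed.

Section continuous_semigroup.
Context {R : realType} {X : normedModType R} (K : set X) (coneK : cone K).
Context (closedK : closed K) (S : R -> clin X X) (B : R).
Context (semigroupS : positive_C0_semigroup K S).
Context (B0 : 0 < B).
Context (SB : forall t x, 0 <= t -> `|S t x| <= B * `|x|).

Let SK t : 0 <= t -> positive_op K (S t).
Proof. by have [+ _ _ _] := semigroupS; exact. Qed.

Let S0 x : S 0 x = x.
Proof. by have [_ -> _ _] := semigroupS. Qed.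

Let SD s t x : 0 <= s -> 0 <= t -> S (s + t) x = S s (S t x).
Proof.
by move=> s0 t0; have [_ _ SD _] := semigroupS; rewrite (SD s t s0 t0).
Qed.

Lemma semigroup_sub s t x : 0 <= s -> s <= t -> S t x = S (t - s) (S s x).
Proof. by move=> s0 st; rewrite -SD ?subr_ge0// subrK. Qed.

(** Near time zero an order unit stays in the interior; this propagates to
    all interior points by positivity and to all times by the semigroup law. *)
Lemma semigroup_interior t x : 0 <= t -> K° x -> K° (S t x).
Proof.
move=> t0 Kx; have [_ _ _ /(_ x)/continuous_within_itvcyP[_]] := semigroupS.
rewrite S0 => /(_ _ (nbhs_interior Kx)) [/= e e0 eS].
have small y s : 0 <= s -> s < e -> K° y -> K° (S s y).
  move=> s0 se Ky; have Kx' : K° (S s x).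
    move: s0; rewrite le_eqVlt => /predU1P[<-|s0]; first by rewrite S0.
    by apply: (eS s) => //=; rewrite sub0r normrN gtr0_norm.
  have [c c0 cK] := interior_subZ x Ky.
  apply: (interior_ge coneK c0 Kx'); rewrite -linearZ -linearB; apply: SK => //.
  exact: interior_subset.
(* an arbitrary time is a multiple of a short one *)
have iter_small y s n : 0 <= s -> s < e -> K° y -> K° (S (n%:R * s) y).
  move=> s0 se; elim: n y => [|n IHn] y Ky; first by rewrite mul0r S0.
  rewrite -natr1 mulrDl mul1r SD// ?mulr_ge0//; apply: IHn; exact: small.
have [n tn] : exists n, t / e < n.+1%:R.
  by exists (Num.truncn (t / e)); rewrite truncnS_gt.
have -> : t = n.+1%:R * (t / n.+1%:R) by rewrite mulrC divfK.
apply: iter_small => //; first exact: divr_ge0.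
by rewrite ltr_pdivrMr// mulrC -ltr_pdivrMr.
Qed.

(** Closeness at one time persists, since S t - A = S (t - s) (S s - A). *)
Lemma semigroup_norm_cvg (A : clin X X) :
  (forall t x, 0 <= t -> S t (A x) = A x) ->
  (forall e : R, 0 < e -> exists2 t, 0 <= t & `|S t - A| <= e) ->
  `|S t - A| @[t --> +oo] --> (0 : R).
Proof.
move=> SA Se; apply/cvgr0Pnorm_lt => e e0.
have [s s0 se] := Se (e / 2 / B) (divr_gt0 (divr_gt0 e0 (ltr0Sn _ _)) B0).
near=> t; rewrite normr_id; apply: (@le_lt_trans _ _ (e / 2)); last first.
  by rewrite ltr_pdivrMr// ltr_pMr// ltr1n.
have st : s <= t by near: t; apply: nbhs_pinfty_ge; rewrite num_real.
apply: clin_norm_le => x x1.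
have -> : (S t - A) x = S (t - s) ((S s - A) x).
  rewrite -[LHS]/(S t x - A x) -[(S s - A) x]/(S s x - A x) linearB/=.
  by rewrite SA ?subr_ge0// -semigroup_sub.
rewrite (le_trans (SB _ _))// ?subr_ge0// mulrC -ler_pdivlMr//.
exact: le_trans (clin_norm_ub _ x1) se.
Unshelve. all: by end_near. Qed.

Lemma semigroup_pointwise_cvg (u x : X) (a : R) :
  (forall t, 0 <= t -> S t u = u) ->
  (forall e : R, 0 < e -> exists2 t, 0 <= t & `|S t x - a *: u| < e) ->
  S t x @[t --> +oo] --> a *: u.
Proof.
move=> Su Se; apply/cvgrPdistC_lt => e e0.
have [s s0 se] := Se (e / B) (divr_gt0 e0 B0).
near=> t.
have st : s <= t by near: t; apply: nbhs_pinfty_ge; rewrite num_real.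
have -> : S t x - a *: u = S (t - s) (S s x - a *: u).
  rewrite [S _ (_ - _)]linearB/= [S _ (a *: u)]linearZ/= Su ?subr_ge0//.
  by rewrite -semigroup_sub.
by rewrite (le_lt_trans (SB _ _))// ?subr_ge0// mulrC -ltr_pdivlMr.
Unshelve. all: by end_near. Qed.

Lemma semigroup_limit_invariant (A : clin X X) :
  (forall x, S t x @[t --> +oo] --> A x) -> forall t x, 0 <= t ->
  A (S t x) = A x /\ S t (A x) = A x.
Proof.
move=> SA t x t0.
have SAt : S s (S t x) @[s --> +oo] --> A x.
  apply/cvgrPdist_lt => e e0.
  have /cvgrPdist_lt/(_ e e0)[M [Mr ME]] := SA x.
  exists (Num.max 0 M); split=> [|s]; first by rewrite num_real.
  rewrite gt_max => /andP[/ltW s0 Ms].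
  by rewrite -SD//; apply: ME; rewrite ltr_wpDr.
split; first exact: (cvg_unique (@norm_hausdorff _ _) (SA _) SAt).
have StA : S t (S s x) @[s --> +oo] --> S t (A x).
  by apply: cvg_comp (SA x) _; exact: clin_continuous.
apply: (cvg_unique (@norm_hausdorff _ _) StA).
apply: cvg_trans SAt; apply: near_eq_cvg; near=> s.
have s0 : 0 <= s by near: s; apply: nbhs_pinfty_ge; rewrite num_real.
by rewrite -!SD// addrC.
Unshelve. all: by end_near. Qed.

(** A bounded, pointwise convergent family converges uniformly on compact sets,
    in particular on the closure of the image of the unit ball under S tau; and
    S (t + tau) - A = (S t - A) (S tau). *)
Lemma semigroup_uniform_cvg (tau : R) (A : clin X X) : 0 <= tau ->
  compact_op (S tau) -> (forall x, S t x @[t --> +oo] --> A x) ->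
  `|S t - A| @[t --> +oo] --> (0 : R).
Proof.
move=> tau0; rewrite /compact_op precompactE => /compact_near_coveringP cS SA.
apply: semigroup_norm_cvg => [t x t0|e e0].
  exact: (semigroup_limit_invariant SA x t0).2.
have BA : 0 < B + `|A| by rewrite ltr_pwDl// clin_norm_ge0.
have : \forall t \near +oo,
    closure (S tau @` [set x | `|x| <= 1]) `<=` [set y | `|S t y - A y| < e].
  apply: (cS R (+oo : set_system R) (fun t y => `|S t y - A y| < e)) => y _.
  have e2 : 0 < e / 2 by exact: divr_gt0.
  have /cvgrPdistC_lt/(_ _ e2) Sy := SA y.
  exists (ball y (e / 2 / (B + `|A|)),
      [set t | 0 <= t] `&` [set t | `|S t y - A y| < e / 2]).
    split; first by apply: nbhsx_ballx; exact: divr_gt0.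
    by apply: filterI => //; apply: nbhs_pinfty_ge; rewrite num_real.
  move=> [y' t] /= [yy' [t0 Sty]].
  have -> : S t y' - A y' = (S t (y' - y) - A (y' - y)) + (S t y - A y).
    rewrite [S t (_ - _)]linearB [A (_ - _)]linearB/= opprB addrACA subrK.
    by rewrite [X in _ = _ + X]addrAC subrr sub0r.
  rewrite (le_lt_trans (ler_normD _ _))// [e in _ < e]splitr ltr_leD// ?ltW//.
  rewrite (le_lt_trans (ler_normB _ _))//.
  rewrite (le_lt_trans (lerD (SB _ t0) (le_clin_norm _ _)))//.
  rewrite -mulrDl mulrC -ltr_pdivlMr//.
  by move: yy'; rewrite -ball_normE/= distrC.
move=> unif; near (+oo : set_system R) => t.
have t0 : 0 <= t by near: t; apply: nbhs_pinfty_ge; rewrite num_real.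
exists (t + tau); first exact: addr_ge0.
apply: clin_norm_le => x x1.
rewrite -[(S (t + tau) - A) x]/(S (t + tau) x - A x) SD//.
rewrite -(semigroup_limit_invariant SA x tau0).1 ltW//.
have : closure (S tau @` [set x | `|x| <= 1]) `<=` [set y | `|S t y - A y| < e].
  by near: t.
by apply; apply: subset_closure; exists x.
Unshelve. all: by end_near. Qed.

(** The coefficient of u in the limit is unique, hence linear in x; it is
    continuous because the orbit of x is bounded by a multiple of the norm
    of x. *)
Lemma semigroup_limit_functional (u : X) : u != 0 ->
  (forall t, 0 <= t -> S t u = u) ->
  (forall x, exists a : R, forall e : R, 0 < e ->
    exists2 t, 0 <= t & `|S t x - a *: u| < e) ->
  exists f : dual X, forall x, S t x @[t --> +oo] --> (f x : R) *: u.
Proof.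
move=> u0 Su /choice[f fP].
have Sf x : S t x @[t --> +oo] --> f x *: u.
  by apply: semigroup_pointwise_cvg => // e e0; exact: fP.
have lf : linear (f : X -> R^o).
  move=> k x y; apply: (scale_vector_inj u0); rewrite scalerDl -scalerA.
  apply: (cvg_unique (@norm_hausdorff _ _) (Sf _)).
  have -> : (fun t => S t (k *: x + y)) = (fun t => k *: S t x + S t y).
    by apply/funext => t; rewrite linearP.
  by apply: cvgD => //; exact: cvgZl_tmp.
have fB x : `|f x| * `|u| <= B * `|x|.
  rewrite -normrZ; apply/ler_addgt0Pr => e e0.
  have [t t0 te] := fP x e e0.
  rewrite -(subrK (S t x) (f x *: u)) addrC (le_trans (ler_normD _ _))//.
  by rewrite lerD ?SB// distrC ltW.
have nu : 0 < `|u| by rewrite normr_gt0.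
have cf : continuous (f : X -> R^o).
  pose f' : {linear X -> R^o} := HB.pack (f : X -> R^o)
    (GRing.isLinear.Build _ _ _ _ _ lf).
  apply: (@bounded_linear_continuous _ _ _ f').
  apply/linear_boundedP; exists (B / `|u|); split=> [|M /ltW BM x].
    by rewrite num_real.
  rewrite -(ler_pM2r nu) (le_trans (fB x))// mulrAC ler_wpM2r//.
  by rewrite -ler_pdivrMr.
by exists (mkclin lf cf).
Qed.

(** * Fixed vectors and the rank-one limit *)

Context (tau : R) (tau0 : 0 < tau) (ctau : compact_op (S tau)).
Context (hint : forall x, K x -> x != 0 -> exists2 t : R, 0 <= t & K° (S t x)).

Lemma eigenvector_mulrn (u : X) (s c : R) n : 0 <= s -> S s u = c *: u ->
  S (n%:R * s) u = c ^+ n *: u.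
Proof.
move=> s0 Su; elim: n => [|n IHn]; first by rewrite mul0r S0 expr0 scale1r.
by rewrite -natr1 mulrDl mul1r SD ?mulr_ge0// Su linearZ/= IHn scalerA exprS.
Qed.

(** An eigenvalue above one would make the orbit of u unbounded. An eigenvalue
    below one would make it come close to zero, from where bounded operators
    cannot bring it back to u, as periodicity requires. *)
Lemma fixed_vector_eigenvalue (u : X) (s c : R) : u != 0 -> K u ->
  S tau u = u -> 0 <= s -> S s u = c *: u -> c = 1.
Proof.
move=> u0 Ku Sutau s0 Su.
have nu : 0 < `|u| by rewrite normr_gt0.
have c0 : 0 <= c by apply: (coneZ_ge0 coneK Ku u0); rewrite -Su; exact: SK.
have Sun n : S (n%:R * tau) u = u.
  by rewrite (@eigenvector_mulrn u tau 1) ?expr1n ?scale1r// ltW.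
have cB n : c ^+ n <= B.
  rewrite -(ler_pM2r nu) -(ger0_norm (exprn_ge0 n c0)) -normrZ.
  by rewrite -(eigenvector_mulrn n s0 Su) SB// mulr_ge0.
have Bc n : B^-1 <= c ^+ n.
  have [m /ltW mn] := multiple_above (n%:R * s) tau0.
  have ns0 : 0 <= n%:R * s by exact: mulr_ge0.
  have := SB (c ^+ n *: u) (_ : 0 <= m%:R * tau - n%:R * s).
  rewrite subr_ge0 => /(_ mn); rewrite -(eigenvector_mulrn n s0 Su).
  rewrite -SD ?subr_ge0// subrK Sun (eigenvector_mulrn n s0 Su) normrZ.
  rewrite (ger0_norm (exprn_ge0 n c0)) mulrA -[leLHS]mul1r ler_pM2r//.
  by rewrite -ler_pdivrMl// mulr1.
have BV : 0 < B^-1 by rewrite invr_gt0.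
apply/eqP; rewrite eq_le !leNgt; apply/andP; split; apply/negP => c1.
  have cp : 0 < c by exact: lt_trans c1.
  have cV1 : c^-1 < 1 by rewrite invf_lt1.
  have [|n] := expr_small _ cV1 BV; first by rewrite invr_ge0.
  by rewrite exprVn ltf_pV2 ?posrE ?exprn_gt0// ltNge cB.
have [n] := expr_small c0 c1 BV.
by rewrite ltNge Bc.
Qed.

Let P (n : nat) := S (n%:R * tau).

Let PD m n x : P (m + n) x = P m (P n x).
Proof. by rewrite /P natrD mulrDl SD// mulr_ge0// ltW. Qed.

Let P0 x : P 0 x = x. Proof. by rewrite /P mul0r S0. Qed.

Let Pt n : 0 <= n%:R * tau. Proof. by rewrite mulr_ge0// ltW. Qed.

Let P1 : P 1 = S tau. Proof. by rewrite /P mul1r. Qed.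

(** The vector fixed by S tau is fixed by the whole semigroup: S s u is fixed by
    S tau as well, hence equals its own limit, a multiple of u. *)
Lemma persistent_orbit_limit (e : X) (d : R) : K° e -> 0 < d ->
  (forall n, d <= `|P n e|) ->
  exists u, [/\ u != 0, K° u, forall t, 0 <= t -> S t u = u &
    forall x, exists a : R, forall eps : R, 0 < eps ->
      exists2 t, 0 <= t & `|S t x - a *: u| < eps].
Proof.
move=> Ke d0 de.
have PK n : positive_op K (P n) by exact: SK.
have intP n x : K° x -> K° (P n x).
  exact: semigroup_interior.
have Pint x : K x -> x != 0 -> exists n, K° (P n x).
  move=> Kx /(hint Kx)[t t0 Kt]; have [n /ltW tn] := multiple_above t tau0; exists n.
  rewrite /P (semigroup_sub x t0 tn).
  by apply: semigroup_interior; rewrite ?subr_ge0.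
have PB n x : `|P n x| <= B * `|x| by exact: SB.
have cP : compact_op (P 1) by rewrite P1.
have [u [u0 Ku Pu]] :=
  interior_fixed_point coneK closedK P0 PD PK intP Pint cP B0 PB Ke d0 de.
have lim x := orbit_limit coneK closedK P0 PD PK Pint cP B0 PB u0 Ku Pu x.
exists u; split=> // [s s0|x].
  have PSu n : P n (S s u) = S s u.
    have Pnu : P n u = u by elim: n => [|n IHn]; rewrite ?P0// -addn1 PD Pu.
    by rewrite /P -SD// addrC SD// [S _ u]Pnu.
  have [a aP] := lim (S s u).
  have Sa : S s u = a *: u.
    apply/eqP; rewrite -subr_eq0 -normr_le0; apply/ler_addgt0Pr => eps eps0.
    by have [n] := aP eps eps0; rewrite PSu add0r => /ltW.
  rewrite Sa (fixed_vector_eigenvalue u0 (interior_subset Ku) _ s0 Sa).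
    by rewrite scale1r.
  by rewrite -P1.
have [a aP] := lim x; exists a => eps eps0; have [n nP] := aP eps eps0.
by exists (n%:R * tau).
Qed.

Section rank_one_limit.
Context (u : X) (f : dual X) (u0 : u != 0) (Ku : K° u).
Context (Su : forall t, 0 <= t -> S t u = u).
Context (Sf : forall x, S t x @[t --> +oo] --> (f x : R) *: u).

Lemma limit_functional_fixed t : 0 <= t -> adjoint (S t) f = f.
Proof.
move=> t0; apply: clin_ext; apply/funext => x; apply: (scale_vector_inj u0).
exact: (semigroup_limit_invariant (A := tensor f u) (@Sf) x t0).1.
Qed.

Lemma limit_functional_normalized : f u = 1.
Proof.
apply: (scale_vector_inj u0); rewrite scale1r.
apply: (cvg_constant_on_multiples ltr01 _ (@Sf u)) => n /=.
by rewrite Su// mulr_ge0.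
Qed.

Lemma limit_functional_ge0 : dual_cone K f.
Proof.
move=> x Kx; apply: (coneZ_ge0 coneK (interior_subset Ku) u0).
apply: (closed_cvg K closedK _ _ (@Sf x)); exists 0; split=> [|t t0].
  by rewrite num_real.
exact: SK (ltW t0) _ Kx.
Qed.

(** The functional is invariant, so f x = f (S t x), and S t x dominates a
    positive multiple of u. *)
Lemma limit_functional_gt0 x : K x -> x != 0 -> 0 < (f x : R).
Proof.
move=> Kx /(hint Kx)[t t0 /(interior_subZ u)[c c0 /interior_subset Kc]].
have := limit_functional_ge0 Kc; rewrite linearB linearZ/=.
rewrite limit_functional_normalized subr_ge0.
rewrite -[f (S t x)]/(adjoint (S t) f x) limit_functional_fixed//.
by apply: lt_le_trans; rewrite /GRing.scale/= mulr1.
Qed.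

(** A vector fixed by S t equals its own limit, along the multiples of t. *)
Lemma limit_simple_eigenvalue t : 0 < t -> simple_eigenvalue (S t) 1.
Proof.
move=> t0; exists u => //; apply/seteqP; split=> [v /= Sv|_ [c _ <-]]; last first.
  by rewrite /eigenspace_op /= linearZ/= Su ?ltW// scale1r.
exists (f v) => //; apply: (cvg_constant_on_multiples t0 _ (@Sf v)) => n /=.
by rewrite (eigenvector_mulrn n (ltW t0) Sv) expr1n scale1r.
Qed.

(** A functional g fixed by the adjoint of S t is constant on the times n t, hence
    g x is the value of g at the limit f x *: u. *)
Lemma limit_simple_adjoint_eigenvalue t : 0 < t ->
  simple_eigenvalue (adjoint (S t)) 1.
Proof.
move=> t0; exists f.
  apply/eqP => f0; have := limit_functional_normalized.
  by rewrite f0 => /eqP; rewrite eq_sym oner_eq0.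
apply/seteqP; split=> [g /= Sg|_ [c _ <-]]; last first.
  change (adjoint (S t) (c *: f) = 1 *: (c *: f)).
  rewrite scale1r linearZ; congr (_ *: _).
  exact: limit_functional_fixed (ltW t0).
have gS x : g (S t x) = g x.
  by have /(congr1 (fun h : dual X => h x)) := Sg; rewrite scale1r.
have gSn n x : g (S (n%:R * t) x) = g x.
  elim: n => [|n IHn]; first by rewrite mul0r S0.
  have nt0 : 0 <= n%:R * t by rewrite mulr_ge0// ltW.
  by rewrite -natr1 mulrDl mul1r addrC (SD _ (ltW t0) nt0) gS.
exists (g u) => //; apply: clin_ext; apply/funext => x.
have gx : g (S s x) @[s --> +oo] --> g ((f x : R) *: u).
  apply: (@cvg_comp _ _ _ (fun s => S s x) g); first exact: Sf.
  exact: clin_continuous.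
rewrite -(cvg_constant_on_multiples t0 (fun n => gSn n x) gx) linearZ/=.
exact: mulrC.
Qed.

End rank_one_limit.

End continuous_semigroup.

(** * Convergence of the semigroup *)

Theorem theorem4 (R : realType) (X : completeNormedModType R) (K : set X)
    (coneK : cone K) (closedK : closed K) (normalK : normal_cone K)
    (intK : K° !=set0)
    (S : R -> clin X X) (semigroupS : positive_C0_semigroup K S)
    (hint : forall x, K x -> x != 0 -> exists2 t : R, 0 <= t & K° (S t x))
    (hcompact : exists2 tau : R, 0 < tau & compact_op (S tau))
    (hbounded : (ereal_sup [set `|S t|%:E | t in [set t : R | (0 <= t)%R]] < +oo)%E) :
  exists A0 : clin X X,
    [/\ (forall x, S t x @[t --> +oo] --> A0 x),
        (A0 != 0 ->
          exists u : X, exists f0 : dual X,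
            [/\ [/\ K° u, dual_cone K f0 & f0 != 0],
                (* (i) *)
                [/\ forall t, 0 <= t -> S t u = u,
                    forall t, 0 <= t -> adjoint (S t) f0 = f0
                  & forall x, K x -> x != 0 -> 0 < (f0 x : R)],
                (* (ii) *)
                A0 = tensor f0 u,
                (* (iii) *)
                (forall f : dual X,
                  (adjoint (S t) f : weak_star X) @[t --> +oo]
                    --> (adjoint A0 f : weak_star X))
              & (* (iv) *)
                forall t, 0 < t -> simple_eigenvalue (S t) 1 /\
                                   simple_eigenvalue (adjoint (S t)) 1])
      & (* (v) *)
        `|S t - A0| @[t --> +oo] --> (0 : R) /\
        `|adjoint (S t) - adjoint A0| @[t --> +oo] --> (0 : R)].
Proof.
have [SK _ _ _] := semigroupS.
have [e Ke] := intK; have [tau tau0 ctau] := hcompact.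
have [B B0 SB] : exists2 B : R, 0 < B &
    forall t x, 0 <= t -> `|S t x| <= B * `|x|.
  have SM t : 0 <= t -> (`|S t|%:E <=
      ereal_sup [set `|S t|%:E | t in [set t : R | (0 <= t)%R]])%E.
    by move=> t0; apply: ereal_sup_ubound; exists t.
  move: SM hbounded; case: (ereal_sup _) => [M| |] SM // _; last first.
    by have := SM 0 (lexx _).
  exists (`|M| + 1) => [|t x t0]; first by rewrite ltr_wpDl.
  rewrite (le_trans (le_clin_norm _ _))// ler_wpM2r//.
  have := SM t t0; rewrite lee_fin => /le_trans; apply.
  by rewrite (le_trans (ler_norm M))// lerDl.
have [C C0 TC] := normal_op_bound coneK normalK Ke.
(* the sampled orbit of the order unit e either stays away from zero or has
   arbitrarily small points *)
have [[d d0 dS]|vanish] := pselect (exists2 d : R, 0 < d &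
    forall n, d <= `|S (n%:R * tau) e|).
- have [u [u0 Ku Su limu]] :=
    persistent_orbit_limit coneK closedK semigroupS B0 SB tau0 ctau hint Ke d0 dS.
  have [f Sf] := semigroup_limit_functional semigroupS B0 SB u0 Su limu.
  have SA x : S t x @[t --> +oo] --> tensor f u x by exact: Sf.
  have NA := semigroup_uniform_cvg semigroupS B0 SB (ltW tau0) ctau SA.
  exists (tensor f u); split=> //; last by split=> //; exact: norm_cvg_adjoint.
  move=> _; exists u, f; split=> //.
  + split=> //; first exact: (limit_functional_ge0 coneK closedK semigroupS u0 Ku Sf).
    apply/eqP => f0; have := limit_functional_normalized u0 Su Sf.
    by rewrite f0 => /eqP; rewrite eq_sym oner_eq0.
  + split=> //; first exact: (limit_functional_fixed semigroupS u0 Sf).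
    exact: (limit_functional_gt0 coneK closedK semigroupS hint u0 Ku Su Sf).
  + by move=> g; exact: pointwise_cvg_weak_star.
  + move=> t t0; split; first exact: (limit_simple_eigenvalue semigroupS u0 Su Sf t0).
    exact: (limit_simple_adjoint_eigenvalue semigroupS u0 Su Sf t0).
- have NA : `|S t - 0| @[t --> +oo] --> (0 : R).
    apply: (semigroup_norm_cvg semigroupS B0 SB) => [t x t0|eps eps0].
      by rewrite linear0.
    have [n nS] : exists n, `|S (n%:R * tau) e| < eps / C.
      apply: contrapT => nS; apply: vanish; exists (eps / C) => [|n].
        exact: divr_gt0.
      by rewrite leNgt; apply/negP => ?; apply: nS; exists n.
    have n0 : 0 <= n%:R * tau by rewrite mulr_ge0// ltW.
    exists (n%:R * tau) => //; rewrite subr0 (le_trans (TC _ (SK _ n0)))//.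
    by rewrite mulrC -ler_pdivlMr// ltW.
  exists 0; split; first by move=> x; exact: norm_cvg_pointwise.
    by rewrite eqxx.
  by split=> //; exact: norm_cvg_adjoint.
Qed.
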